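(* Let $E$ be an $n$-dimensional vector space over a field $\mathbb{F}$ and let $\tilde{\mathcal{I}}\subseteq\mathcal{L}(E)$ be a collection of subspaces satisfying the axioms (I1), (I2) and (oI4). Then $(E,\tilde{\mathcal{I}})$ is a $q$-matroid, i.e. $\tilde{\mathcal{I}}$ satisfies (I1), (I2), (I3) and (I4).
   Context: $n$ is a positive integer, $\mathbb{F}$ is an arbitrary field, and $\mathcal{L}(E)$ denotes the lattice of all subspaces of $E$; for a subspace $A$, $\mathcal{L}(A)$ is the set of all subspaces of $A$. For a family $\mathcal{A}\subseteq\mathcal{L}(E)$, $\max(\mathcal{A})$ is the set of members of $\mathcal{A}$ that are maximal with respect to inclusion. For $X\in\mathcal{L}(E)$, $\max(X,\mathcal{A})$ is the set of members of $\mathcal{A}$ contained in $X$ that have the largest dimension among all members of $\mathcal{A}$ contained in $X$. Axioms for $\mathcal{I}\subseteq\mathcal{L}(E)$: (I1) $\mathcal{I}\neq\emptyset$. (I2) For all $I,J\in\mathcal{L}(E)$, if $J\in\mathcal{I}$ and $I\subseteq J$, then $I\in\mathcal{I}$. (I3) For all $I,J\in\mathcal{I}$ with $\dim I<\dim J$, there exists a $1$-dimensional subspace $x\subseteq J$, $x\not\subseteq I$, such that $I+x\in\mathcal{I}$. (I4) For all $A,B\in\mathcal{L}(E)$ and $I,J\in\mathcal{L}(E)$ such that $I\in\max(\mathcal{I}\cap\mathcal{L}(A))$ and $J\in\max(\mathcal{I}\cap\mathcal{L}(B))$, there exists $K\in\max(\mathcal{I}\cap\mathcal{L}(A+B))$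 such that $K\subseteq I+J$. (oI4) For all $A,B\in\mathcal{L}(E)$ and $I,J\in\mathcal{L}(E)$ such that $I\in\max(A,\mathcal{I})$ and $J\in\max(B,\mathcal{I})$, there exists $K\in\max(A+B,\mathcal{I})$ such that $K\subseteq I+J$. A $q$-matroid given by a family $\mathcal{I}$ of independent spaces is a pair $(E,\mathcal{I})$ such that $\mathcal{I}$ satisfies (I1)-(I4). *)

(* Defs.v *)
(* Families of subspaces are arbitrary (classical) sets of [{vspace E}]. *)
From mathcomp Require Import all_boot all_algebra.
From mathcomp Require Import boolp classical_sets.

Set Implicit Arguments.
Unset Strict Implicit.
Unset Printing Implicit Defensive.

Local Open Scope ring_scope.
Local Open Scope classical_set_scope.

Section QMatroid.
Variables (F : fieldType) (E : vectType F).
Implicit Types (A B I J K X Y : {vspace E}) (Fam : set {vspace E}).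

Definition subspaces A : set {vspace E} := [set X | (X <= A)%VS].

(* max(Fam), for inclusion; distinct in general from [max_dim]. *)
Definition max_incl Fam : set {vspace E} :=
  [set X | Fam X /\ forall Y, Fam Y -> (X <= Y)%VS -> Y = X].

(* max(X, Fam): among members of [Fam] inside [X], those of largest dimension. *)
Definition max_dim X Fam : set {vspace E} :=
  [set Y | (Fam `&` subspaces X) Y /\
           forall Z, (Fam `&` subspaces X) Z -> (\dim Z <= \dim Y)%N].

Definition axiom_I1 Fam : Prop := Fam !=set0.

Definition axiom_I2 Fam : Prop :=
  forall I J, Fam J -> (I <= J)%VS -> Fam I.

Definition axiom_I3 Fam : Prop :=
  forall I J, Fam I -> Fam J -> (\dim I < \dim J)%N ->
    exists x : {vspace E},
      [/\ \dim x = 1%N, (x <= J)%VS, ~~ (x <= I)%VS & Fam (I + x)%VS].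

Definition axiom_I4 Fam : Prop :=
  forall A B I J,
    max_incl (Fam `&` subspaces A) I -> max_incl (Fam `&` subspaces B) J ->
    exists2 K, max_incl (Fam `&` subspaces (A + B)%VS) K & (K <= I + J)%VS.

Definition axiom_oI4 Fam : Prop :=
  forall A B I J,
    max_dim A Fam I -> max_dim B Fam J ->
    exists2 K, max_dim (A + B)%VS Fam K & (K <= I + J)%VS.

Definition q_matroid Fam : Prop :=
  [/\ axiom_I1 Fam, axiom_I2 Fam, axiom_I3 Fam & axiom_I4 Fam].

End QMatroid.

(* Main.v *)
Require Import Defs.
From mathcomp Require Import all_boot all_algebra.
From mathcomp Require Import boolp classical_sets.

(** The key is that, under (oI4), the spaces in which a fixed space [I] is
    independent of largest dimension are closed under sum ([max_dim_addv]):
    applying (oI4) with [I] on both sides yields an independent space of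
    largest dimension inside [I + I = I].  A one-dimensional extension of [I]
    can only contain an independent space larger than [I] if it is itself
    independent.  Hence, if no extension of [I] by a line of [A] is
    independent, [I] has largest dimension in [I + A], by summing over a
    basis of [A] ([max_dim_extend]).

    Both remaining axioms follow.  For (I3), if no line of [J] extends [I],
    then [I] has largest dimension in [I + J], so [dim J <= dim I].  For (I4),
    an inclusion-maximal independent subspace of [A] has no extension by a
    line of [A], hence it has largest dimension; the two notions of maximality
    coincide ([max_inclE]) and (I4) is (oI4). *)

Set Implicit Arguments.
Unset Strict Implicit.
Unset Printing Implicit Defensive.

Local Open Scope ring_scope.
Local Open Scope classical_set_scope.

Section LargestIndependent.
Variables (F : fieldType) (E : vectType F) (Fam : set {vspace E}).
Implicit Types A B I J X Y : {vspace E}.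

Lemma max_dim_incl A I : max_dim A Fam I -> max_incl (Fam `&` subspaces A) I.
Proof.
move=> [FI maxI]; split=> // Y FY sIY.
by apply/esym/eqP; rewrite eqEdim sIY maxI.
Qed.

(** [I] has codimension at most one in [I + <[x]>], so the only subspace of
    the latter that could beat [I] is the whole space. *)
Lemma max_dim_line I (x : E) :
  Fam I -> (x \notin I -> ~ Fam (I + <[x]>)%VS) -> max_dim (I + <[x]>)%VS Fam I.
Proof.
move=> FI ext; split=> [|Z [FZ sZ]]; first by split=> //; exact: addvSl.
have [xI|xI] := boolP (x \in I).
  apply: dimvS; move/addv_idPl: xI => xI.
  by move: sZ; rewrite /subspaces /= xI.
rewrite leqNgt; apply/negP => ltIZ; apply: (ext xI).
suff /eqP <- : Z == (I + <[x]>)%VS by [].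
rewrite eqEdim sZ (leq_trans (dimv_add_leqif _ _)) //.
rewrite (leq_trans _ ltIZ) // -addn1 leq_add2l dim_vline.
by case: (x != 0).
Qed.

Hypothesis oI4 : axiom_oI4 Fam.

(** (oI4) with the same [I] on both sides gives a member of [Fam] of largest
    dimension in [A + B] lying inside [I + I = I]. *)
Lemma max_dim_addv A B I :
  max_dim A Fam I -> max_dim B Fam I -> max_dim (A + B)%VS Fam I.
Proof.
move=> mA mB; have [K [_ maxK]] := oI4 mA mB.
rewrite addvv => /dimvS leKI.
have [[FI sIA] _] := mA; split.
  by split=> //; exact: (subv_trans sIA (addvSl _ _)).
by move=> Z /maxK/leq_trans; apply.
Qed.

(** Non-extendability by single lines is a local condition; summing the spaces
    [I + <[x]>] over a basis of [A] makes it global. *)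
Lemma max_dim_extend A I :
  Fam I -> (forall x, x \in A -> x \notin I -> ~ Fam (I + <[x]>)%VS) ->
  max_dim (I + A)%VS Fam I.
Proof.
move=> FI ext; rewrite -(span_basis (vbasisP A)).
have: {subset tval (vbasis A) <= A} by move=> x; exact: vbasis_mem.
elim: (tval (vbasis A)) => [_|x s IHs sA].
  rewrite span_nil addv0; split=> [|Z [_ sZI]]; last exact: dimvS.
  by split=> //; exact: subvv.
have mx : max_dim (I + <[x]>)%VS Fam I.
  by apply: max_dim_line => //; apply: ext; apply: sA; rewrite mem_head.
have ms : max_dim (I + <<s>>)%VS Fam I.
  by apply: IHs => y ys; apply: sA; rewrite inE ys orbT.
have := max_dim_addv mx ms.
by rewrite (addvC I) -addvA (addvA I) addvv addvA (addvC _ I) -addvA -span_cons.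
Qed.

(** An inclusion-maximal [I] cannot be extended by a line of [A], so it has
    largest dimension in [I + A = A]. *)
Lemma max_inclE A : max_incl (Fam `&` subspaces A) = max_dim A Fam.
Proof.
apply/seteqP; split=> I; last exact: max_dim_incl.
move=> [[FI sIA] maxI].
have <- : (I + A)%VS = A by apply/addv_idPr.
apply: max_dim_extend => // x xA xI FIx.
have eIx : (I + <[x]>)%VS = I.
  apply: maxI; last exact: addvSl.
  by split=> //; rewrite /subspaces /= subv_add -memvE xA andbT.
by move: xI; rewrite -eIx memvE addvSr.
Qed.

Lemma oI4_I3 : axiom_I3 Fam.
Proof.
move=> I J FI FJ ltIJ; apply: contrapT => noext.
suff [_ /(_ J)] : max_dim (I + J)%VS Fam I.
  by rewrite leqNgt ltIJ => H; have /H : (Fam `&` subspaces (I + J)%VS) J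
    by split=> //; exact: addvSr.
apply: max_dim_extend => // x xJ xI FIx; apply: noext.
exists <[x]>%VS; split=> //.
by rewrite dim_vline (contraNneq _ xI) // => ->; exact: mem0v.
Qed.

Lemma oI4_I4 : axiom_I4 Fam.
Proof. by move=> A B I J; rewrite !max_inclE; exact: oI4. Qed.

End LargestIndependent.

Theorem theorem16 (n : nat) (hn : (0 < n)%N) (F : fieldType) (E : vectType F)
    (hE : \dim {: E} = n) (Itilde : set {vspace E}) :
  axiom_I1 Itilde -> axiom_I2 Itilde -> axiom_oI4 Itilde -> q_matroid Itilde.
Proof.
by move=> I1 I2 oI4; split=> //; [exact: oI4_I3 | exact: oI4_I4].
Qed.
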